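(* Let $N$ be a positive integer. Any solution to the peg puzzle with parameter $N$ requires at least $N^2+2N$ moves.
   Context: The peg puzzle. Let $N$ be a positive integer. The apparatus consists of $N$ red pegs, $N$ blue pegs, and a block with a single row of $2N+1$ equally spaced holes, each hole containing at most one peg. Initially the $N$ blue pegs occupy the leftmost $N$ holes, the $N$ red pegs occupy the rightmost $N$ holes, and the center hole is empty. The goal is to reach the position in which the red pegs occupy the leftmost $N$ holes, the blue pegs occupy the rightmost $N$ holes (and the center hole is empty). Allowable moves are of two types: a step, in which one peg moves from an occupied hole into the adjacent (unique) empty hole; and a jump, in which one peg jumps over a single adjacent peg (of either color) into the empty hole on the other side of that peg. Steps and jumps may be made in either direction by pegs of either color. A solution is a finite sequence of allowable moves taking the initial position to the goal position; pegs of the same color need not end in any particular order. *)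

(* Defs.v *)
From HB Require Import structures.
From mathcomp Require Import all_boot.
Set Implicit Arguments.
Unset Strict Implicit.
Unset Printing Implicit Defensive.

Inductive color := Blue | Red.

Definition color_is_red (c : color) : bool := if c is Red then true else false.
Definition color_of_bool (b : bool) : color := if b then Red else Blue.

Lemma color_is_redK : cancel color_is_red color_of_bool.
Proof. by case. Qed.

HB.instance Definition _ := Finite.copy color (can_type color_is_redK).

(* Pegs of one color are interchangeable, so a position records only the color
   of the peg in each hole; [None] is an empty hole, and holes are numbered
   from left to right. *)
Definition hole (N : nat) : finType := 'I_(2 * N + 1).

Definition position (N : nat) : finType := {ffun hole N -> option color}.

(* [two_blocks c d]: color c in the N leftmost holes, color d in the N
   rightmost ones, center hole (number N) empty. *)
Definition two_blocks (N : nat) (c d : color) : position N :=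
  [ffun i : hole N =>
     if i < N then Some c else if N < i then Some d else None].

Definition initial_position (N : nat) : position N := two_blocks N Blue Red.
Definition goal_position (N : nat) : position N := two_blocks N Red Blue.

Definition occupied (N : nat) (p : position N) (i : hole N) : bool :=
  p i != None.

Definition adjacent (N : nat) (i j : hole N) : bool :=
  (i.+1 == j :> nat) || (j.+1 == i :> nat).

Definition transfer (N : nat) (p : position N) (i j : hole N) : position N :=
  [ffun k => if k == j then p i else if k == i then None else p k].

Definition step (N : nat) : rel (position N) := fun p q =>
  [exists i : hole N, exists j : hole N,
     [&& occupied p i, ~~ occupied p j, adjacent i j & q == transfer p i j]].

(* The condition [i != j] puts the landing hole j on the other side of the
   hole k that is jumped over. *)
Definition jump (N : nat) : rel (position N) := fun p q =>
  [exists i : hole N, exists k : hole N, exists j : hole N,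
     [&& occupied p i, occupied p k, ~~ occupied p j,
         adjacent i k, adjacent k j, i != j & q == transfer p i j]].

Definition move (N : nat) : rel (position N) := fun p q => step p q || jump p q.

(* s lists the positions reached after each successive move, without the
   initial position, so the number of moves is [size s]. *)
Definition is_solution (N : nat) (s : seq (position N)) : bool :=
  path (@move N) (initial_position N) s
  && (last (initial_position N) s == goal_position N).

(* Main.v *)
Require Import Defs.
From mathcomp Require Import all_boot.
From mathcomp Require Import zify.

Set Implicit Arguments.
Unset Strict Implicit.
Unset Printing Implicit Defensive.

(** A solution has two independent costs: at least [N ^ 2] jumps and at least
    [2 * N] steps.

    Delete the hole from a position; what remains is a word [w] in the two
    colors, together with the location of the hole. A step moves the hole past
    one letter and leaves [w] alone. A jump moves the hole past two adjacent
    letters and exchanges them (with no effect on [w] when they are equal).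

    Jumps: let [A m] be the number of red letters among the first [m]. An
    exchange changes a single value of [A], by at most one
    ([total_count_swapped]), while the sum of all the values has to grow by
    [N ^ 2] ([total_count_goal]).

    Steps: the letters exchanged by a jump straddle a boundary whose parity is
    fixed by the parity of the hole, and only steps change the latter. Thus
    between two consecutive steps all the exchanges take place in a fixed
    pairing of adjacent letters, and these pairings alternate: the word is
    being sorted by odd-even transposition. In such a sort the [j]-th red
    letter from the left cannot start before its predecessor has left, and then
    advances by at most one place per round. The invariant [delayed] says this,
    and [delayed_swapped] shows that jumps preserve it. For the last red letter
    to cover its [N] places it takes at least [2 * N - 1] steps, and their number
    is even since the hole returns to the center. *)

(** * Exchanges of adjacent letters in a binary word *)

Definition prefix_count (w : nat -> bool) (m : nat) : nat := \sum_(k < m) w k.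

Definition swapped (i : nat) (w w' : nat -> bool) : Prop :=
  [/\ w' i = w i.+1, w' i.+1 = w i
    & forall k, k != i -> k != i.+1 -> w' k = w k].

Lemma prefix_countS w m : prefix_count w m.+1 = prefix_count w m + w m.
Proof. by rewrite /prefix_count big_ord_recr. Qed.

Lemma prefix_count_ext w w' : w =1 w' -> prefix_count w =1 prefix_count w'.
Proof. by move=> eq_w m; apply: eq_bigr => k _; rewrite eq_w. Qed.

Lemma prefix_count_swapped i w w' m : swapped i w w' ->
  prefix_count w' m =
    if m == i.+1 then prefix_count w i + w i.+1 else prefix_count w m.
Proof.
case=> w'i w'Si w'E.
have below n : n <= i -> prefix_count w' n = prefix_count w n.
  by move=> le_ni; apply: eq_bigr => k _; rewrite w'E //; have := ltn_ord k; lia.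
have above d : prefix_count w' (i.+2 + d) = prefix_count w (i.+2 + d).
  elim: d => [|d IHd].
    by rewrite addn0 !prefix_countS below // w'i w'Si addnAC.
  by rewrite addnS (prefix_countS w') (prefix_countS w) IHd w'E //; lia.
case: eqP => [->|/eqP m_neq]; first by rewrite prefix_countS below // w'i.
have [/below //|lt_im] := leqP m i.
by rewrite (_ : m = i.+2 + (m - i.+2)) ?above //; lia.
Qed.

Definition total_count (n : nat) (w : nat -> bool) : nat :=
  \sum_(m < n) prefix_count w m.

Lemma total_count_ext n w w' : w =1 w' -> total_count n w = total_count n w'.
Proof. by move=> eq_w; apply: eq_bigr => m _; apply: prefix_count_ext. Qed.

(** The value of [prefix_count] that an exchange modifies lies between two
    values that differ by at most one, before and after the exchange. *)
Lemma total_count_swapped n i w w' : swapped i w w' ->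
  total_count n w' <= (total_count n w).+1.
Proof.
move=> sw; rewrite /total_count; elim: n => [|n IHn]; first by rewrite !big_ord0.
rewrite !big_ord_recr /= (prefix_count_swapped n sw).
case: eqP => [n_eq|_]; last by rewrite -addSn leq_add2r.
have -> : \sum_(m < n) prefix_count w' m = \sum_(m < n) prefix_count w m.
  apply: eq_bigr => m _; rewrite (prefix_count_swapped m sw) ifN //.
  by have := ltn_ord m; lia.
rewrite -addnS leq_add2l n_eq prefix_countS -addnS leq_add2l.
by case: (w i.+1).
Qed.

(** * The delay of odd-even transposition *)

(** The marked letters (those equal to [true]) start at ranks
    [N + 1, ..., 2 * N] and move left; round [t] is what happens after exactly
    [t] steps. The invariant bounds below the rank of the [a]-th marked letter:
    either by its initial value [N + a], or by [N + a - (t - (a - 1))], which is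
    one less for every round from round [a] on, the first one in which that
    letter may move. Quantifying over prefixes rather than over marked letters
    makes the effect of an exchange local. *)
Definition delayed (N t : nat) (w : nat -> bool) : Prop :=
  forall m, let a := prefix_count w m in
  [\/ a = 0, N + a <= m | N + a.*2 <= m + t.+1].

Lemma delayedS N t w w' : w' =1 w -> delayed N t w -> delayed N t.+1 w'.
Proof.
move=> eq_w del m /=; rewrite (prefix_count_ext eq_w).
case: (del m) => [H|H|H]; [exact: Or31|exact: Or32|apply: Or33; lia].
Qed.

(** Only the prefix of length [i.+1] is affected, and only an exchange that
    brings a marked letter into it matters. Let [a] be the number of marked
    letters in the prefix of length [i]. The bound for the prefix of length
    [i.+2], which has [a + 1] of them, falls short of the required one by at
    most one. When it is the bound that depends on [t], the parity hypothesis
    rules out equality. When it is [N + a < i.+2] and is attained, the bound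
    for the prefix of length [i] says that the previous marked letter, if any,
    has left its initial place, so that [a <= t], and parity makes this
    inequality strict. *)
Lemma delayed_swapped N t i w w' : odd i = odd (N + t) -> swapped i w w' ->
  delayed N t w -> delayed N t w'.
Proof.
move=> par sw del m /=; rewrite (prefix_count_swapped m sw).
case: eqP => [->|_]; last exact: del.
have {del} := (del i, del i.+1, del i.+2); rewrite /= !prefix_countS.
move: (prefix_count w i) => a [[deli delSi delSSi]].
suff: [|| a + w i.+1 == 0, N + (a + w i.+1) <= i.+1
        | N + (a + w i.+1).*2 <= i.+1 + t.+1].
  by case/or3P=> [/eqP|H|H]; [exact: Or31|exact: Or32|exact: Or33].
move: deli delSi delSSi; case: (w i); case: (w i.+1) => /=.
all: by case=> ?; case=> ?; case=> ?; lia.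
Qed.

(** * The word of a position *)

Section Words.
Variable N : nat.
Implicit Types (p : position N) (h i j : hole N).

Definition red_at p (k : nat) : bool :=
  if insub k is Some i then p i == Some Red else false.

Lemma red_at_ord p i : red_at p i = (p i == Some Red).
Proof. by rewrite /red_at valK. Qed.

Lemma red_at_transfer p i j k : red_at (transfer p i j) k =
  if k == j then red_at p i else if k == i then false else red_at p k.
Proof.
rewrite red_at_ord /red_at; case: insubP => [x _ <-|k_ge].
  by rewrite ffunE -!val_eqE /=; case: ifP => //; case: ifP.
by rewrite !ifN //; apply: contraNneq k_ge => ->; apply: ltn_ord.
Qed.

Definition only_hole p h : Prop := forall k, occupied p k = (k != h).

Lemma only_hole_transfer p h i : only_hole p h -> i != h ->
  only_hole (transfer p i h) i.
Proof.
move=> ph i_neq k; have := ph i; have := ph k; rewrite /occupied ffunE i_neq.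
have [->|_] := eqVneq k h; first by move=> _ ->; rewrite eq_sym.
by have [->|_] := eqVneq k i.
Qed.

(** The [k]-th letter of the word obtained by deleting the hole [h]; the letter
    is [true] for a red peg. *)
Definition word p h (k : nat) : bool := red_at p (k + (h <= k)).

Lemma word_step p h i : adjacent i h -> word (transfer p i h) i =1 word p h.
Proof.
move=> adj k; rewrite /word red_at_transfer.
case: eqP => [e|e]; first by congr red_at; move: adj e; rewrite /adjacent; lia.
case: eqP => [e'|e']; first by move: e'; lia.
by congr red_at; move: adj e; rewrite /adjacent; lia.
Qed.

Lemma word_jump p h k i : adjacent i k -> adjacent k h -> i != h ->
  swapped (minn h i) (word p h) (word (transfer p i h) i).
Proof.
rewrite /adjacent -val_eqE /= => ik kh ih.
split=> [||l li lSi]; rewrite /word red_at_transfer.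
all: case: eqP => [e|e]; first by congr red_at; lia.
all: case: eqP => [e'|e']; first by lia.
all: by congr red_at; lia.
Qed.

End Words.

(** * Counting steps and jumps along a sequence of moves *)

Section Solutions.
Variable N : nat.

(** Among [n] moves [t] are steps, and each of the [n - t] jumps increases
    [total_count] by at most one from its initial value, which is the sum of
    the truncated differences [m - N]. *)
Definition progress (p : position N) (n : nat) : Prop :=
  exists h t, [/\ only_hole p h, odd h = odd (N + t), delayed N t (word p h)
    & total_count (2 * N + 1) (word p h) + t
      <= \sum_(m < 2 * N + 1) (m - N) + n].

Lemma progress_move p q n :
  move p q -> progress p n -> progress q n.+1.
Proof.
move=> pq [h [t [ph par del tot]]].
have hole_eq j : ~~ occupied p j -> j = h.
  by rewrite ph negbK => /eqP.
case/orP: pq.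
  case/existsP=> i /existsP[j] /and4P[pi /hole_eq-> adj /eqP->].
  exists i, t.+1; split.
  - by apply: only_hole_transfer; rewrite // -ph.
  - by move: adj par; rewrite /adjacent; lia.
  - exact: delayedS (word_step _ adj) del.
  - by rewrite (total_count_ext _ (word_step p adj)) (addnS _ t) (addnS _ n) ltnS.
case/existsP=> i /existsP[k] /existsP[j].
case/and5P=> pi _ /hole_eq-> ik /and3P[kh ih /eqP->].
have sw := word_jump p ik kh ih.
have par2 : odd i = odd h /\ odd (minn h i) = odd h.
  by move: ik kh; rewrite /adjacent; lia.
exists i, t; split.
- exact: only_hole_transfer.
- by rewrite par2.1.
- by apply: delayed_swapped sw del; rewrite par2.2.
- by have := total_count_swapped (2 * N + 1) sw; lia.
Qed.

Lemma two_blocks_center : N < 2 * N + 1.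
Proof. by lia. Qed.

Definition center : hole N := Ordinal two_blocks_center.

Lemma only_hole_two_blocks c d : only_hole (two_blocks N c d) center.
Proof. by move=> k; rewrite /occupied ffunE -val_eqE /=; case: ltngtP. Qed.

Lemma word_two_blocks c d k : word (two_blocks N c d) center k =
  if k < N then color_is_red c else (k < 2 * N) && color_is_red d.
Proof.
rewrite /word /red_at /=; case: insubP => [i k_lt i_val|k_ge].
  rewrite ffunE i_val; case: (leqP N k) => Nk; last first.
    by rewrite addn0 Nk; case: c.
  have -> : k + true < N = false by lia.
  have -> : N < k + true by lia.
  by have -> : k < 2 * N by lia.
have -> : k < N = false by lia.
by have -> : k < 2 * N = false by lia.
Qed.

Lemma prefix_count_initial m : m <= 2 * N ->
  prefix_count (word (initial_position N) center) m = m - N.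
Proof.
elim: m => [|m IHm] m_le; first by rewrite /prefix_count big_ord0.
by rewrite prefix_countS IHm 1?ltnW // word_two_blocks; case: (ltnP m N) => /=; lia.
Qed.

Lemma prefix_count_goal m :
  prefix_count (word (goal_position N) center) m = minn m N.
Proof.
elim: m => [|m IHm]; first by rewrite /prefix_count big_ord0 min0n.
by rewrite prefix_countS IHm word_two_blocks; case: (ltnP m N) => /=; lia.
Qed.

Lemma total_count_goal :
  total_count (2 * N + 1) (word (goal_position N) center)
  = \sum_(m < 2 * N + 1) (m - N) + N ^ 2.
Proof.
(* Both summands are linear on each side of [m = N]. *)
have split_sum (F : nat -> nat) : \sum_(m < 2 * N + 1) F m
    = \sum_(m < N) F m + \sum_(m < N) F (N + m) + F (2 * N).
  by rewrite addn1 big_ord_recr /= mul2n -addnn big_split_ord.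
rewrite /total_count; under eq_bigr do rewrite prefix_count_goal.
rewrite (split_sum (minn^~ N)) (split_sum (subn^~ N)).
have -> : \sum_(m < N) minn m N = \sum_(m < N) m.
  by apply: eq_bigr => m _; rewrite (minn_idPl (ltnW _)).
have -> : \sum_(m < N) minn (N + m) N = \sum_(m < N) N.
  by apply: eq_bigr => m _; rewrite (minn_idPr (leq_addr _ _)).
have -> : \sum_(m < N) (m - N) = 0.
  by rewrite big1 // => m _; apply/eqP; rewrite subn_eq0 ltnW.
have -> : \sum_(m < N) (N + m - N) = \sum_(m < N) m.
  by apply: eq_bigr => m _; rewrite addKn.
by rewrite sum_nat_const card_ord; move: (\sum_(m < N) m) => S; lia.
Qed.

Lemma progress_initial : progress (initial_position N) 0.
Proof.
exists center, 0; split.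
- exact: only_hole_two_blocks.
- by rewrite addn0.
- move=> m /=; have [le_m|lt_m] := leqP m (2 * N).
    rewrite prefix_count_initial //; have [|] := leqP m N.
      by rewrite -subn_eq0 => /eqP; apply: Or31.
    by move=> ?; apply: Or32; lia.
  suff: prefix_count (word (initial_position N) center) m <= N.
    by move=> ?; apply: Or32; lia.
  rewrite (_ : m = 2 * N + (m - 2 * N)); last lia.
  elim: (m - _) => [|d IHd]; first by rewrite addn0 prefix_count_initial; lia.
  by rewrite addnS prefix_countS word_two_blocks ifN /=; lia.
- rewrite !addn0 /total_count; apply: leq_sum => m _.
  by rewrite prefix_count_initial //; have := ltn_ord m; lia.
Qed.

Lemma progress_path s :
  path (@move N) (initial_position N) s ->
  progress (last (initial_position N) s) (size s).
Proof.
elim/last_ind: s => [_|s q IHs]; first exact: progress_initial.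
rewrite rcons_path last_rcons size_rcons => /andP[/IHs bound sq].
exact: progress_move sq bound.
Qed.

End Solutions.

Theorem theorem2 (N : nat) (N_gt0 : 0 < N) (s : seq (position N))
    (s_sol : is_solution s) :
  N ^ 2 + 2 * N <= size s.
Proof.
case/andP: s_sol => /progress_path + /eqP goal; rewrite goal.
case=> h [t [gh par del tot]].
have h_eq : h = center N.
  have := gh (center N); rewrite only_hole_two_blocks eqxx.
  by move/esym/negbFE/eqP.
move: par del tot; rewrite h_eq total_count_goal => /= par /(_ N) /=.
rewrite prefix_count_goal minnn => del tot.
(* The prefix of length [N] is all red, so that [3 * N <= N + t.+1]; as the hole
   is back at the center, [t] is even. *)
have : 2 * N <= t by case: del => ?; lia.
lia.
Qed.
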